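(* Let $\delta_0, \delta^+ \in \Delta$ with $\delta_0 < \delta^+$, and let all densities $p_{\delta^+}$ be taken relative to $P_{\delta_0}$. Let $(T_n)_{n \in \mathbb{N}}$, $T_n = t_n(U^n)$, be a sequence of statistics such that for each $n$, $T_n$ is sufficient for the model $\{P_\delta : \delta \in \Delta\}$ and data $U^n$, and $T_n$ satisfies the Monotone Likelihood Ratio (MLR) Property. Then the process $$\Bigl(\prod_{i=1}^n p_{\delta^+}^{T_i}(T_i \mid U^{i-1})\Bigr)_{n \in \mathbb{N}}$$ is identical to the likelihood ratio process $\bigl(p_{\delta^+}^{U^n}(U^n)\bigr)_{n \in \mathbb{N}}$, and both are test supermartingales relative to the one-sided null hypothesis $\mathcal{H}_{\delta \le \delta_0} = \{P_\delta : \delta \in \Delta, \delta \le \delta_0\}$, in the filtration $(\sigma(U^n))_{n \in \mathbb{N}}$.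
   Context: Setting. $U_1, U_2, \ldots$ is a stochastic process, where $U_i$ has support $\mathcal{U}_i \subset \mathbb{R}$. Write $U^n = (U_1,\ldots,U_n)$ and $\mathcal{U}^{(n)} = \mathcal{U}_1 \times \cdots \times \mathcal{U}_n$; for $n=1$ the past $u^{0}$ is empty and conditioning on it is no conditioning. $\{P_\delta : \delta \in \Delta\}$ is a one-parameter statistical model for this process, with $\Delta \subseteq \mathbb{R}$ an interval. Standing assumption: for all $\delta \in \Delta$ there is a version of the conditional distribution $P_\delta(U_i = \cdot \mid U^{i-1})$ such that, for all $i$, all $u^{i-1} \in \mathcal{U}^{(i-1)}$ and all $\delta \in \Delta$, the distributions $P_\delta(U_i = \cdot \mid U^{i-1} = u^{i-1})$ are mutually absolutely continuous (across $\delta$), share the same support $\mathcal{U}_i$, and have densities $f_\delta^{U_i}(\cdot \mid u^{i-1})$ relative to Lebesgue or counting measure that coincide with their elementary conditional densities (joint density divided by marginal density). These densities are taken to be positive on $\mathcal{U}_i$, so that likelihood ratios are defined everywhere on the support. Likelihood ratio notation. Fix $\delta_0 \in \Delta$. The symbol $p_\delta$ always denotes a density of $P_\delta$ relative to $P_{\delta_0}$: for a random quantity $V$, $p_\delta^V(v) = f_\delta^V(v)/f_{\delta_0}^V(v)$, the density of the law of $V$ under $P_\delta$ relative to its law under $P_{\delta_0}$; $p_\delta^{U_n}(u \mid u^{n-1}) = f_\delta^{U_n}(u \mid u^{n-1})/f_{\delta_0}^{U_n}(u \mid u^{n-1})$; and $p_\delta^{U^n}(u^n) = \prod_{i=1}^n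 p_\delta^{U_i}(u_i \mid u^{i-1})$. For a statistic $T_n = t_n(U^n)$, $p_\delta^{T_n}(\cdot \mid u^{n-1})$ is the density of the conditional law of $T_n$ given $U^{n-1}=u^{n-1}$ under $P_\delta$ relative to the conditional law of $T_n$ given $U^{n-1}=u^{n-1}$ under $P_{\delta_0}$, i.e. $p_\delta^{T_n}(t \mid u^{n-1}) = \mathbf{E}_{\delta_0}[p_\delta^{U_n}(U_n \mid u^{n-1}) \mid U^{n-1}=u^{n-1},\, t_n(u^{n-1},U_n) = t]$ for possible values $t$; since such a conditional expectation is determined only up to null sets, pointwise statements about it refer to a suitable version. Sufficiency. $T_n$ is a sufficient statistic for $\{P_\delta : \delta \in \Delta\}$ and data $U^n$ if, with $f_\delta^{T_n}$ and $f_\delta^{U^n}$ denoting densities of $T_n$ and $U^n$ under $P_\delta$ relative to some ($\delta$-independent) background measures, there are functions $t_n : \mathcal{U}^{(n)} \to \mathbb{R}$ and $q_n : \mathcal{U}^{(n)} \to \mathbb{R}^+$ such that $T_n = t_n(U^n)$ and, for all $\delta \in \Delta$ and all $u^n \in \mathcal{U}^{(n)}$, $$f_\delta^{U^n}(u^n) = f_\delta^{T_n}(t_n(u^n)) \cdot q_n(u^n).$$ MLR Property. A real random variable $T$ with common support (set of possible values) $\mathcal{T}$ under all $P_\delta$, $\delta \in \Delta$, satisfies the MLR Property if for all $\delta_0, \delta^+ \in \Delta$ with $\delta_0 \le \delta^+$, the likelihood ratio $p_{\delta^+}^T(t) = f_{\delta^+}^T(t)/f_{\delta_0}^T(t)$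 is increasing as a function of $t \in \mathcal{T}$. Throughout, ''increasing'' is meant in the non-strict sense. Test supermartingale. A process $(M_n)_{n\in\mathbb{N}}$ adapted to $(\sigma(U^n))_{n \in \mathbb{N}}$, extended by $M_0 = 1$, is a test supermartingale relative to a null hypothesis $\mathcal{H}$ (a set of distributions for the process) if it is non-negative and is a supermartingale under every $P \in \mathcal{H}$, i.e. $\mathbf{E}_P[M_n \mid U^{n-1}] \le M_{n-1}$ for all $n \ge 1$. For the likelihood ratio process this amounts to: for all $\delta \in \Delta$ with $\delta \le \delta_0$, all $n \geq 1$ and all $u^{n-1} \in \mathcal{U}^{(n-1)}$, $\mathbf{E}_\delta[p_{\delta^+}^{U_n}(U_n \mid u^{n-1}) \mid U^{n-1}=u^{n-1}] \le 1$. *)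

(* Defs.v *)
(* The process U_1, U_2, ... is indexed from 0: U i is U_{i+1}.
   A past u^n is an n.-tuple, so f d n past is the conditional density under
   P_d of the (n+1)-st observation given U^n = past; for n = 0 the past is the
   empty tuple.  A statistic t n takes the first n observations. *)
From HB Require Import structures.
From mathcomp Require Import all_boot all_order all_algebra.
From mathcomp Require Import all_classical all_reals all_analysis.

Set Implicit Arguments.
Unset Strict Implicit.
Unset Printing Implicit Defensive.

Import Order.TTheory GRing.Theory Num.Theory.
Import numFieldNormedType.Exports.

Local Open Scope classical_set_scope.
Local Open Scope ring_scope.

Definition has_density (d : measure_display) (T : measurableType d)
    (R : realType) (m nu : set T -> \bar R) (g : T -> R) : Prop :=
  [/\ measurable_fun [set: T] g,
      forall x, 0 <= g x &
      forall B, measurable B -> m B = (\int[nu]_(x in B) (g x)%:E)%E].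

Section histories.
Context {R : realType}.

Definition support_path (S : nat -> set R) (n : nat) : set (n.-tuple R) :=
  [set u | forall i : 'I_n, S i (tnth u i)].

(* The first i entries of u, for i <= n; the default 0 of nth is never used. *)
Definition prefix_tuple (n : nat) (u : n.-tuple R) (i : nat) : i.-tuple R :=
  [tuple nth 0 u j | j < i].

Definition hist (Omega : Type) (U : nat -> Omega -> R) (n : nat)
    (w : Omega) : n.-tuple R :=
  [tuple U i w | i < n].

Definition hist_sigma (Omega : Type) (U : nat -> Omega -> R) (n : nat) :
    set (set Omega) :=
  preimage_set_system [set: Omega] (hist U n) measurable.

End histories.

Arguments support_path {R} S n _.

Section model.
Context {R : realType} {dO : measure_display} {Omega : measurableType dO}.
Implicit Types (Delta : set R) (P : R -> probability Omega R).
Implicit Types (U : nat -> {mfun Omega >-> R}) (S : nat -> set R).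
Implicit Types (f : forall (d : R) (n : nat), n.-tuple R -> R -> R).
Implicit Types (kappa : R -> forall n : nat, R.-pker (n.-tuple R) ~> R).

(* kappa d n is the chosen version of P_d(U_{n+1} = . | U^n).  Since the
   densities of all the P_d are relative to the same mu n and are positive
   exactly on S n, the conditional distributions are mutually absolutely
   continuous; the joint density of U^n relative to the product of the mu i is
   joint_density below, whose successive quotients are the f d n. *)
Record process_model Delta P U S (mu : nat -> {measure set R -> \bar R})
    kappa f : Prop := ProcessModel {
  kappa_cond_distribution : forall d n, Delta d ->
    forall (A : set (n.-tuple R)) (B : set R), measurable A -> measurable B ->
    P d ((hist U n @^-1` A) `&` (U n @^-1` B)) =
    (\int[P d]_(w in hist U n @^-1` A) kappa d n (hist U n w) B)%E ;
  base_lebesgue_or_counting : forall n,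
    mu n = lebesgue_measure :> (set R -> \bar R) \/
    mu n = counting :> (set R -> \bar R) ;
  density_jointly_measurable : forall d n, Delta d ->
    measurable_fun [set: n.-tuple R * R] (fun x => f d n x.1 x.2) ;
  kappa_density : forall d n past, Delta d -> support_path S n past ->
    has_density (kappa d n past) (mu n) (f d n past) ;
  density_support : forall d n past, Delta d -> support_path S n past ->
    forall u, S n u <-> 0 < f d n past u }.

Definition joint_density f (d : R) (n : nat) (u : n.-tuple R) : R :=
  \prod_(i < n) f d i (prefix_tuple u i) (tnth u i).

(* p_d^{U_{n+1}}(u | past), relative to P_{d0}. *)
Definition cond_lr f (d0 d : R) (n : nat) (past : n.-tuple R) (u : R) : R :=
  f d n past u / f d0 n past u.

(* p_d^{U^n}(u), relative to P_{d0}. *)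
Definition joint_lr f (d0 d : R) (n : nat) (u : n.-tuple R) : R :=
  \prod_(i < n) cond_lr f d0 d (prefix_tuple u i) (tnth u i).

(* g d is the density under P_d of T_n = t(U^n) relative to nu; the density of
   U^n is the one relative to the product of the mu i, any other common
   background measure only changing q. *)
Definition sufficient Delta P U S f (n : nat) (t : n.-tuple R -> R)
    (nu : {measure set R -> \bar R}) (g : R -> R -> R) : Prop :=
  (forall d, Delta d ->
     has_density (pushforward (P d) (t \o hist U n)) nu (g d)) /\
  exists q : n.-tuple R -> R,
    (forall u, support_path S n u -> 0 <= q u) /\
    forall d u, Delta d -> support_path S n u ->
      joint_density f d u = g d (t u) * q u.

(* g d is the density under P_d of a statistic with set of values V. *)
Definition mlr_property Delta (V : set R) (g : R -> R -> R) : Prop :=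
  forall d0 d1, Delta d0 -> Delta d1 -> d0 <= d1 ->
    forall x y, V x -> V y -> x <= y -> g d1 x / g d0 x <= g d1 y / g d0 y.

Definition stat_cond_law kappa (t : forall n, n.-tuple R -> R) (d : R)
    (n : nat) (past : n.-tuple R) : set R -> \bar R :=
  pushforward (kappa d n past)
    (fun u => t n.+1 [tuple of rcons past u]).

(* pT n past is a version of the density p_d^{T_{n+1}}( . | past), relative to
   P_{d0}; such a density is only determined up to null sets. *)
Definition stat_cond_lr_version S kappa (t : forall n, n.-tuple R -> R)
    (d0 d : R) (pT : forall n, n.-tuple R -> R -> R) : Prop :=
  forall n,
    [/\ measurable_fun [set: n.-tuple R * R] (fun x => pT n x.1 x.2),
        forall past x, 0 <= pT n past x &
        forall past, support_path S n past ->
          has_density (stat_cond_law kappa t d past)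
            (stat_cond_law kappa t d0 past) (pT n past)].

(* prod_{i=1}^n p^{T_i}(T_i | u^{i-1}), as a function of u = u^n. *)
Definition stat_lr_product (t : forall n, n.-tuple R -> R)
    (pT : forall n, n.-tuple R -> R -> R) (n : nat) (u : n.-tuple R) : R :=
  \prod_(i < n) pT i (prefix_tuple u i) (t i.+1 (prefix_tuple u i.+1)).

Definition measurable_wrt (G : set (set Omega)) (X : Omega -> R) : Prop :=
  forall B, measurable B -> G (X @^-1` B).

Definition cond_expectation (Q : probability Omega R) (G : set (set Omega))
    (X Y : Omega -> R) : Prop :=
  [/\ measurable_wrt G Y,
      Q.-integrable [set: Omega] (EFin \o Y) &
      forall A, G A ->
        (\int[Q]_(w in A) (Y w)%:E = \int[Q]_(w in A) (X w)%:E)%E].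

Definition supermartingale (Q : probability Omega R) U
    (M : nat -> Omega -> R) : Prop :=
  [/\ forall n, measurable_wrt (hist_sigma U n) (M n),
      forall n, Q.-integrable [set: Omega] (EFin \o M n) &
      forall n, exists2 Y : Omega -> R,
        cond_expectation Q (hist_sigma U n) (M n.+1) Y &
        {ae Q, forall w, Y w <= M n w}].

Definition test_supermartingale (H : set (probability Omega R)) U
    (M : nat -> Omega -> R) : Prop :=
  [/\ forall w, M 0%N w = 1,
      forall n w, 0 <= M n w &
      forall Q, H Q -> supermartingale Q U M].

Definition one_sided_null Delta P (d0 : R) : set (probability Omega R) :=
  [set P d | d in [set d | Delta d /\ d <= d0]].

End model.

(* Main.v *)
(* By sufficiency the factor q cancels in the ratio of the joint densities of
   U^n, so that, given the past, the likelihood ratio of U_n equals a positive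
   constant times the likelihood ratio of T_n.  This function of T_n is a version
   of the conditional likelihood ratio of T_n, hence the two processes agree.
   For the supermartingale property let d <= d0 < d+ and work given the past.
   By MLR the ratio X = p_{d+}/p_{d0} is increasing in T_n, while
   Y = p_d/p_{d0} is decreasing in T_n, and both have mean 1 under P_{d0}.
   Choosing y such that (X - 1)(Y - y) <= 0 everywhere and integrating gives
   E_d[X] = E_{d0}[X Y] <= 1. *)
Require Import Defs.
From HB Require Import structures.
From mathcomp Require Import all_boot all_order all_algebra.
From mathcomp Require Import all_classical all_reals all_analysis.
From mathcomp Require Import measurable_realfun ring lra.

Set Implicit Arguments.
Unset Strict Implicit.
Unset Printing Implicit Defensive.

Import Order.TTheory GRing.Theory Num.Theory.
Import numFieldNormedType.Exports.

Local Open Scope classical_set_scope.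
Local Open Scope ring_scope.

(** * Measure theory *)

(** Inversion is continuous on the open set of nonzero reals, and any function on a singleton is
    measurable; the two pieces cover the line. *)
Lemma measurable_invr (R : realType) : measurable_fun [set: R] (@GRing.inv R).
Proof.
rewrite -(setUv [set 0]); apply/measurable_funU => //; first exact: measurableC.
split; first exact: measurable_fun_set1.
rewrite (_ : ~` [set 0] = [set x : R | x != 0]); last first.
  by apply/seteqP; split => x /= /eqP.
apply: open_continuous_measurable_fun; first exact: open_neq.
by move=> x /[!inE] /= x0; exact: inv_continuous.
Qed.

Lemma measurable_divr d (T : measurableType d) (R : realType) (D : set T)
    (f g : T -> R) :
  measurable_fun D f -> measurable_fun D g ->
  measurable_fun D (fun x => f x / g x).
Proof.
move=> mf mg; apply: measurable_funM => //.
exact: (measurableT_comp (@measurable_invr R) mg).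
Qed.

Lemma measurable_neqr d (T : measurableType d) (R : realType) (f g : T -> R) :
  measurable_fun setT f -> measurable_fun setT g ->
  measurable [set x | f x <> g x].
Proof.
move=> /measurable_EFinP mf /measurable_EFinP mg.
rewrite (_ : [set _ | _] = setT `&` [set x | (EFin \o f) x != (EFin \o g) x]).
  exact: measurable_neqe.
rewrite setTI; apply/seteqP; split => x /=.
  by move=> fg; apply/eqP => -[].
by move=> /eqP fg fgx; apply: fg; rewrite fgx.
Qed.

(** * From measures of sets to integrals of nonnegative functions *)

Section monotone_functional.
Context d (X : measurableType d) (R : realType).
Variables (m : {measure set X -> \bar R}) (Phi : (X -> \bar R) -> \bar R).
Local Open Scope ereal_scope.
Hypothesis Phi_indic : forall A, measurable A -> Phi (EFin \o \1_A) = m A.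
Hypothesis PhiD : forall f g, measurable_fun setT f -> measurable_fun setT g ->
  (forall x, 0 <= f x) -> (forall x, 0 <= g x) -> Phi (f \+ g) = Phi f + Phi g.
Hypothesis PhiZ : forall (r : R) f, measurable_fun setT f ->
  (forall x, 0 <= f x) -> (0 <= r)%R -> Phi (fun x => r%:E * f x) = r%:E * Phi f.
Hypothesis Phi_lim : forall u : nat -> X -> \bar R,
  (forall n, measurable_fun setT (u n)) -> (forall n x, 0 <= u n x) ->
  (forall x, {homo u ^~ x : n m / (n <= m)%N >-> (n <= m)}) ->
  Phi (fun x => limn (u ^~ x)) = limn (fun n => Phi (u n)).
Import HBNNSimple.

(** The standard machine: additivity and homogeneity carry the agreement on indicators to simple
    functions, and [Phi_lim] carries it to their increasing limits. *)
Lemma monotone_functional_integral (f : X -> \bar R) :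
  measurable_fun setT f -> (forall x, 0 <= f x) -> Phi f = \int[m]_x f x.
Proof.
move=> mf f0; pose h := nnsfun_approx measurableT mf.
have mh n : measurable_fun setT (EFin \o h n) by exact/measurable_EFinP.
have h0 n x : 0 <= (EFin \o h n) x by rewrite lee_fin.
have ndh x : {homo (fun n => (EFin \o h n) x) : n m / (n <= m)%N >-> n <= m}.
  by move=> a b ab; rewrite lee_fin; exact/lefP/nd_nnsfun_approx.
have fE : f = (fun x => limn (fun n => (EFin \o h n) x)).
  by apply/funext => x; apply/esym/cvg_lim => //; exact: cvg_nnsfun_approx.
rewrite [in LHS]fE Phi_lim// [in RHS]fE monotone_convergence//.
congr (lim (_ @ \oo)); apply/funext => n; set g := h n.
(* A simple function is the sum, over its finitely many values, of the value times the indicator of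
   its fibre; the induction below runs over the list of these values. *)
have gE : EFin \o g = fun x => \sum_(y <- finmap.enum_fset (fset_set (range g)))
    (y%:E * (\1_(g @^-1` [set y]) x)%:E).
  by apply/funext => x /=; rewrite fimfunE -fsumEFin// fsbig_finite.
rewrite gE.
have : forall y, y \in finmap.enum_fset (fset_set (range g)) -> (0 <= y)%R.
  by move=> y; rewrite in_fset_set// inE => -[x _ <-].
have mI y : measurable_fun setT (fun x => (\1_(g @^-1` [set y]) x)%:E : \bar R).
  exact/measurable_EFinP.
have I0 y x : 0 <= (\1_(g @^-1` [set y]) x)%:E :> \bar R by rewrite lee_fin.
elim: (finmap.enum_fset _) => [|y s IH] s0.
  rewrite [LHS](_ : _ = Phi (EFin \o \1_set0)); last first.
    by congr Phi; apply/funext => x; rewrite big_nil /= indic0.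
  rewrite Phi_indic// measure0 integral0_eq// => x _.
  by rewrite big_nil.
have y0 : (0 <= y)%R by apply: s0; rewrite mem_head.
have s0' z : z \in s -> (0 <= z)%R by move=> zs; apply: s0; rewrite inE zs orbT.
have m1 : measurable_fun setT (fun x => y%:E * (\1_(g @^-1` [set y]) x)%:E).
  exact: measurable_funeM.
have p1 x : 0 <= y%:E * (\1_(g @^-1` [set y]) x)%:E by rewrite mule_ge0.
have m2 : measurable_fun setT (fun x =>
    \sum_(z <- s) (z%:E * (\1_(g @^-1` [set z]) x)%:E)).
  by apply: emeasurable_sum => z; exact: measurable_funeM.
have p2 x : 0 <= \sum_(z <- s) (z%:E * (\1_(g @^-1` [set z]) x)%:E).
  rewrite big_seq; apply: sume_ge0 => z zs; rewrite mule_ge0// lee_fin.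
  exact: s0'.
rewrite (_ : (fun x => _) = (fun x => y%:E * (\1_(g @^-1` [set y]) x)%:E) \+
    (fun x => \sum_(z <- s) (z%:E * (\1_(g @^-1` [set z]) x)%:E))); last first.
  by apply/funext => x; rewrite big_cons.
rewrite PhiD// ge0_integralD// IH// PhiZ// ge0_integralZl//.
by rewrite Phi_indic// integral_indic// setIT.
Qed.

End monotone_functional.

(** As a functional of [f], the right side meets the hypotheses of [monotone_functional_integral].
    The argument covers counting measure on the line, which is not sigma-finite. *)
Lemma integral_has_density d (T : measurableType d) (R : realType)
    (m nu : {measure set T -> \bar R}) (g : T -> R) (f : T -> \bar R) :
  has_density m nu g -> measurable_fun setT f -> (forall x, 0 <= f x)%E ->
  (\int[m]_x f x = \int[nu]_x (f x * (g x)%:E))%E.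
Proof.
move=> [mg g0 mE] mf f0.
have mg' : measurable_fun setT (EFin \o g) by exact/measurable_EFinP.
have g0' x : (0 <= (g x)%:E)%E by rewrite lee_fin.
apply/esym/(@monotone_functional_integral _ _ _ _
  (fun f => \int[nu]_x (f x * (g x)%:E))%E) => //.
- move=> A mA; rewrite mE// [RHS]integral_mkcond; apply: eq_integral => x _ /=.
  by rewrite patchE indicE; case: ifP; rewrite ?mul1e ?mul0e.
- move=> u v mu mv u0 v0; rewrite -ge0_integralD//.
  + by apply: eq_integral => x _ /=; rewrite ge0_muleDl.
  + by move=> x _; rewrite mule_ge0.
  + exact: emeasurable_funM.
  + by move=> x _; rewrite mule_ge0.
  + exact: emeasurable_funM.
- move=> r u mu u0 r0; rewrite -ge0_integralZl//.
  + by apply: eq_integral => x _ /=; rewrite muleA.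
  + exact: emeasurable_funM.
  + by move=> x _; rewrite mule_ge0.
- move=> u mu u0 ndu; rewrite -monotone_convergence//.
  + apply: eq_integral => x _; apply/esym/cvg_lim => //; apply: cvgeZr => //.
    exact/ereal_nondecreasing_is_cvgn/ndu.
  + by move=> n; exact: emeasurable_funM.
  + by move=> n x _; rewrite mule_ge0.
  + by move=> x _ i j ij; rewrite lee_wpmul2r// ndu.
Qed.

(** * Disintegration of a joint law along a kernel *)

Section disintegration.
Context d d1 d2 (Omega : measurableType d) (X : measurableType d1)
  (Y : measurableType d2) (R : realType).
Variables (Q : probability Omega R) (h : Omega -> X) (V : Omega -> Y).
Variable k : R.-pker X ~> Y.
Hypotheses (mh : measurable_fun setT h) (mV : measurable_fun setT V).
Local Open Scope ereal_scope.
Hypothesis kE : forall A B, measurable A -> measurable B ->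
  Q ((h @^-1` A) `&` (V @^-1` B)) = \int[Q]_(w in h @^-1` A) k (h w) B.

(** The semidirect product of the law of [h] with the kernel [k], written as an integral over
    [Omega]. *)
Let m2 (B : set (X * Y)) := \int[Q]_w k (h w) (xsection B (h w)).

Let mk B : measurable B ->
  measurable_fun setT (fun w => k (h w) (xsection B (h w))).
Proof.
move=> mB; apply: (measurableT_comp (f := fun x => k x (xsection B x))) => //.
by apply: measurable_fun_xsection_finite_kernel; rewrite inE.
Qed.

Let m20 : m2 set0 = 0.
Proof. by rewrite /m2 integral0_eq// => w _; rewrite xsection0 measure0. Qed.

Let m2_ge0 B : 0 <= m2 B.
Proof. exact: integral_ge0. Qed.

Let m2_sigma_additive : semi_sigma_additive m2.
Proof.
move=> F mF tF mUF; rewrite [X in _ --> X](_ : _ =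
    \int[Q]_w (\sum_(n <oo) k (h w) (xsection (F n) (h w)))); last first.
  apply: eq_integral => w _; rewrite xsection_bigcup measure_semi_bigcup//.
  - by move=> n; exact: measurable_xsection.
  - exact: trivIset_xsection.
  - by apply: bigcupT_measurable => n; exact: measurable_xsection.
rewrite integral_nneseries//; last by move=> n; exact: mk.
by apply: is_cvg_nneseries => n _ _; exact: integral_ge0.
Qed.

HB.instance Definition _ := isMeasure.Build _ _ _ m2 m20 m2_ge0 m2_sigma_additive.

Let mhV : measurable_fun setT (fun w => (h w, V w)).
Proof. exact: measurable_fun_pair. Qed.

(** Measurable rectangles form a generating pi-system that contains the whole space; on them the
    claim is [kE], and the total mass is finite, so uniqueness of measures applies. *)
Let law_pairE B : measurable B -> pushforward Q (fun w => (h w, V w)) B = m2 B.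
Proof.
move=> mB.
pose C := [set A `*` B | A in @measurable _ X & B in @measurable _ Y].
apply: (@measure_unique _ _ _ C (fun=> setT)) => //.
- by rewrite measurable_prod_measurableType.
- move=> _ _ [X1 mX1 [X2 mX2 <-]] [Y1 mY1 [Y2 mY2 <-]].
  exists (X1 `&` Y1); first exact: measurableI.
  by exists (X2 `&` Y2); [exact: measurableI|rewrite setXI].
- by move=> _; exists setT => //; exists setT => //; rewrite setXTT.
- by rewrite bigcup_const//; exists 0%N.
- move=> _ [A mA [D mD <-]]; rewrite /pushforward /m2 /=.
  rewrite [LHS](_ : _ = Q ((h @^-1` A) `&` (V @^-1` D)))// kE//.
  rewrite integral_mkcond; apply: eq_integral => w _.
  rewrite patchE; case: ifPn => hw.
    by rewrite in_xsectionX//; move: hw; rewrite !inE.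
  by rewrite notin_xsectionX ?measure0//; apply: contra hw; rewrite !inE.
- move=> _ /=; rewrite /pushforward preimage_setT.
  by rewrite probability_setT ltry.
Qed.

(** On indicators this is [law_pairE]; the iterated integral is additive, homogeneous and continuous
    along increasing sequences, so it is the integral against the joint law. *)
Lemma disintegration (F : X * Y -> \bar R) :
  measurable_fun setT F -> (forall z, 0 <= F z) ->
  \int[Q]_w F (h w, V w) = \int[Q]_w \int[k (h w)]_y F (h w, y).
Proof.
move=> mF F0.
have mint (u : X * Y -> \bar R) : measurable_fun setT u -> (forall z, 0 <= u z) ->
    measurable_fun setT (fun w => \int[k (h w)]_y u (h w, y)).
  move=> mu u0.
  apply: (measurableT_comp (f := fun x => \int[k x]_y u (x, y))) => //.
  exact: measurable_fun_integral_sfinite_kernel.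
have msec (u : X * Y -> \bar R) x :
    measurable_fun setT u -> measurable_fun setT (fun y => u (x, y)).
  by move=> mu; exact: (measurableT_comp mu (pair1_measurable x)).
transitivity (\int[pushforward Q (fun w => (h w, V w))]_z F z).
  by rewrite ge0_integral_pushforward.
apply/esym/(@monotone_functional_integral _ _ _ _
  (fun u => \int[Q]_w \int[k (h w)]_y u (h w, y))) => //.
- move=> A mA; rewrite [RHS]law_pairE//; apply: eq_integral => w _.
  have mAw := measurable_xsection (h w) mA.
  rewrite -[in RHS](setIT (xsection A (h w))) -integral_indic//.
  by apply: eq_integral => y _ /=; rewrite !indicE mem_xsection.
- move=> u v mu mv u0 v0; rewrite -ge0_integralD//; try exact: mint.
  + by apply: eq_integral => w _; rewrite -ge0_integralD//; exact: msec.
  + by move=> w _; exact: integral_ge0.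
  + by move=> w _; exact: integral_ge0.
- move=> r u mu u0 r0; rewrite -ge0_integralZl//; last 2 first.
  + exact: mint.
  + by move=> w _; exact: integral_ge0.
  by apply: eq_integral => w _; rewrite -ge0_integralZl//; exact: msec.
- move=> u mu u0 ndu; rewrite -monotone_convergence//.
  + apply: eq_integral => w _; rewrite -monotone_convergence//.
    by move=> n; exact: msec.
  + by move=> n; exact: mint.
  + by move=> n w _; exact: integral_ge0.
  + move=> w _ i j ij; apply: ge0_le_integral => //; [exact: msec..|].
    by move=> y _; exact: ndu.
Qed.

End disintegration.

(** * Histories *)

Section prefixes.
Context {R : realType}.

Lemma nth_prefix_tuple n (u : n.-tuple R) i j :
  (j < i)%N -> nth 0 (prefix_tuple u i) j = nth 0 u j.
Proof. by move=> ji; rewrite (nth_mktuple _ 0 (Ordinal ji)). Qed.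

Lemma prefix_tuple_rcons n (u : n.-tuple R) x i : (i <= n)%N ->
  prefix_tuple [tuple of rcons u x] i = prefix_tuple u i.
Proof.
move=> lin; apply: eq_from_tnth => j; rewrite !(tnth_nth 0).
by rewrite !nth_prefix_tuple//= nth_rcons size_tuple (leq_trans (ltn_ord j) lin).
Qed.

Lemma prefix_tuple_id n (u : n.-tuple R) : prefix_tuple u n = u.
Proof.
by apply: eq_from_tnth => j; rewrite !(tnth_nth 0) nth_prefix_tuple.
Qed.

Lemma prefix_tupleS n (u : n.-tuple R) (i : 'I_n) :
  prefix_tuple u i.+1 = [tuple of rcons (prefix_tuple u i) (tnth u i)].
Proof.
apply: eq_from_tnth => j; rewrite 2!(tnth_nth 0) nth_prefix_tuple//.
rewrite -[RHS]/(nth 0 (rcons (prefix_tuple u i) (tnth u i)) j).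
rewrite nth_rcons size_tuple; have := ltn_ord j.
rewrite ltnS leq_eqVlt => /predU1P[->|ji].
  by rewrite ltnn eqxx (tnth_nth 0).
by rewrite ji nth_prefix_tuple.
Qed.

Lemma tnth_rcons_lt n (u : n.-tuple R) x (i : 'I_n) :
  tnth [tuple of rcons u x] (widen_ord (leqnSn n) i) = tnth u i.
Proof. by rewrite !(tnth_nth 0)/= nth_rcons size_tuple ltn_ord. Qed.

Lemma tnth_rcons_max n (u : n.-tuple R) x :
  tnth [tuple of rcons u x] ord_max = x.
Proof. by rewrite (tnth_nth 0)/= nth_rcons size_tuple ltnn eqxx. Qed.

Lemma support_path_rcons (S : nat -> set R) n (u : n.-tuple R) x :
  support_path S n.+1 [tuple of rcons u x] <-> support_path S n u /\ S n x.
Proof.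
split=> [Su|[Su Sx] i].
  split.
    by move=> i; rewrite -(tnth_rcons_lt u x); exact: (Su (widen_ord _ i)).
  by have := Su ord_max; rewrite tnth_rcons_max.
have [ni|ni] := ltnP i n.
  have -> : i = widen_ord (leqnSn n) (Ordinal ni) by exact: val_inj.
  by rewrite tnth_rcons_lt; exact: Su.
have -> : i = ord_max by apply/val_inj/eqP; rewrite eqn_leq ni -ltnS ltn_ord.
by rewrite tnth_rcons_max.
Qed.

Lemma tuple_rcons n (u : n.+1.-tuple R) :
  u = [tuple of rcons (prefix_tuple u n) (tnth u ord_max)].
Proof. by rewrite -[LHS]prefix_tuple_id (prefix_tupleS u ord_max). Qed.

Lemma support_path_prefix (S : nat -> set R) n (u : n.-tuple R) (i : nat) :
  (i <= n)%N -> support_path S n u -> support_path S i (prefix_tuple u i).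
Proof.
move=> lin Su j; rewrite (tnth_nth 0) nth_prefix_tuple//.
have jn : (j < n)%N by exact: leq_trans lin.
by have := Su (Ordinal jn); rewrite (tnth_nth 0).
Qed.

(** The common form of [joint_density], [joint_lr] and [stat_lr_product], so that their recursion,
    vanishing, positivity and measurability are proved once. *)
Definition path_prod (F : forall n, n.-tuple R -> R -> R) n (u : n.-tuple R) :=
  \prod_(i < n) F i (prefix_tuple u i) (tnth u i).

Lemma path_prod_rcons F n (u : n.-tuple R) x :
  path_prod F [tuple of rcons u x] = path_prod F u * F n u x.
Proof.
rewrite /path_prod big_ord_recr /=; congr (_ * _).
  apply: eq_bigr => i _.
  by rewrite prefix_tuple_rcons ?tnth_rcons_lt// ltnW.
by rewrite prefix_tuple_rcons// prefix_tuple_id tnth_rcons_max.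
Qed.

(* Off the support, the factor at the first coordinate that leaves it is zero. *)
Lemma path_prod_notin_support (S : nat -> set R) F n (u : n.-tuple R) :
  (forall m p x, support_path S m p -> ~ S m x -> F m p x = 0) ->
  ~ support_path S n u -> path_prod F u = 0.
Proof.
move=> F0; elim: n u => [|n IH] u; first by case; case.
rewrite [u]tuple_rcons path_prod_rcons support_path_rcons => nS.
have [Sp|Sp] := pselect (support_path S n (prefix_tuple u n)).
  by rewrite F0 ?mulr0// => Sx; exact: nS.
by rewrite IH ?mul0r.
Qed.

Lemma path_prod_gt0 (S : nat -> set R) F n (u : n.-tuple R) :
  (forall m p x, support_path S m p -> S m x -> 0 < F m p x) ->
  support_path S n u -> 0 < path_prod F u.
Proof.
move=> F0 Su; apply: prodr_gt0 => i _; apply: F0; last exact: Su.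
exact: (support_path_prefix (ltnW (ltn_ord i))).
Qed.

Lemma measurable_prefix_tuple n (i : nat) : (i <= n)%N ->
  measurable_fun setT (fun u : n.-tuple R => prefix_tuple u i).
Proof.
move=> lin; apply/measurable_fun_tnthP => j /=.
have jn : (j < n)%N by exact: leq_trans lin.
rewrite (_ : _ \o _ = fun u => tnth u (Ordinal jn)); last first.
  by apply/funext => u /=; rewrite (tnth_nth 0) nth_prefix_tuple// (tnth_nth 0).
exact: measurable_tnth.
Qed.

Lemma measurable_path_prod F n :
  (forall m, measurable_fun [set: m.-tuple R * R] (fun z => F m z.1 z.2)) ->
  measurable_fun setT (@path_prod F n).
Proof.
move=> mF; apply: measurable_prod => i _.
apply: (measurableT_comp (mF i) (f := fun z => F i z.1 z.2)
  (g := fun u => (prefix_tuple u i, tnth u i))).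
apply: measurable_fun_pair; last exact: measurable_tnth.
by apply: measurable_prefix_tuple; exact: ltnW (ltn_ord i).
Qed.

Lemma measurable_tuple_rcons d (T : measurableType d) n (g : T -> n.-tuple R)
    (x : T -> R) : measurable_fun setT g -> measurable_fun setT x ->
  measurable_fun setT (fun z => [tuple of rcons (g z) (x z)]).
Proof.
move=> mg mx; apply/measurable_fun_tnthP => i /=.
have [ni|ni] := ltnP i n.
  rewrite (_ : _ \o _ = fun z => tnth (g z) (Ordinal ni)).
    exact: (measurableT_comp (@measurable_tnth _ R n (Ordinal ni)) mg).
  apply/funext => z /=; rewrite -[RHS](tnth_rcons_lt _ (x z)).
  by rewrite (_ : widen_ord _ _ = i)//; exact: val_inj.
rewrite (_ : _ \o _ = x)//; apply/funext => z /=.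
rewrite (_ : i = ord_max) ?tnth_rcons_max//.
by apply/val_inj/eqP; rewrite eqn_leq ni -ltnS ltn_ord.
Qed.

Lemma histS (Omega : Type) (U : nat -> Omega -> R) n w :
  hist U n.+1 w = [tuple of rcons (hist U n w) (U n w)].
Proof.
apply: eq_from_tnth => i; rewrite tnth_mktuple.
have [ni|ni] := ltnP i n.
  have -> : i = widen_ord (leqnSn n) (Ordinal ni) by exact: val_inj.
  by rewrite tnth_rcons_lt tnth_mktuple.
have -> : i = ord_max by apply/val_inj/eqP; rewrite eqn_leq ni -ltnS ltn_ord.
by rewrite tnth_rcons_max.
Qed.

Lemma measurable_hist d (Omega : measurableType d)
    (U : nat -> {mfun Omega >-> R}) n :
  measurable_fun setT (hist (fun i => U i : Omega -> R) n).
Proof.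
apply/measurable_fun_tnthP => i /=.
rewrite (_ : _ \o _ = U i)//.
by apply/funext => w /=; rewrite tnth_mktuple.
Qed.

End prefixes.

(** * Conditional distributions of the process *)

Section model_facts.
Context (R : realType) (dO : measure_display) (Omega : measurableType dO).
Variables (Delta : set R) (P : R -> probability Omega R)
  (U : nat -> {mfun Omega >-> R}) (S : nat -> set R)
  (mu : nat -> {measure set R -> \bar R})
  (kappa : R -> forall n : nat, R.-pker (n.-tuple R) ~> R)
  (f : forall (d : R) (n : nat), n.-tuple R -> R -> R).
Hypothesis hmodel : process_model Delta P U S mu kappa f.

Lemma cond_density_gt0 d n p x : Delta d -> support_path S n p -> S n x ->
  0 < f d p x.
Proof. by move=> Dd Sp /(density_support hmodel Dd Sp). Qed.

Lemma cond_density_ge0 d n p x : Delta d -> support_path S n p -> 0 <= f d p x.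
Proof. by move=> Dd Sp; have [_ + _] := kappa_density hmodel Dd Sp; exact. Qed.

Lemma cond_density_eq0 d n p x : Delta d -> support_path S n p -> ~ S n x ->
  f d p x = 0.
Proof.
move=> Dd Sp nSx; apply/eqP; rewrite eq_le cond_density_ge0// andbT leNgt.
by apply/negP => /(density_support hmodel Dd Sp).
Qed.

Lemma measurable_cond_density d n p : Delta d -> support_path S n p ->
  measurable_fun setT (f d p).
Proof. by move=> Dd Sp; have [] := kappa_density hmodel Dd Sp. Qed.

Lemma integral_cond_density d n p : Delta d -> support_path S n p ->
  (\int[mu n]_x (f d p x)%:E = 1)%E.
Proof.
move=> Dd Sp; have [_ _ <-//] := kappa_density hmodel Dd Sp.
exact: prob_kernel.
Qed.

(** An empty [S n] would make the conditional density vanish identically, against its total mass 1;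
    so every supported path can be extended. *)
Lemma support_path_nonempty d n : Delta d -> exists p, support_path S n p.
Proof.
move=> Dd; elim: n => [|n [p Sp]]; first by exists [tuple]; case.
suff [x Sx] : S n !=set0.
  by exists [tuple of rcons p x]; apply/support_path_rcons.
apply/set0P/negP => /eqP S0; have := integral_cond_density Dd Sp.
rewrite integral0_eq => [[/esym/eqP]|x _]; first by rewrite oner_eq0.
by rewrite cond_density_eq0// S0.
Qed.

(** With one supported past [p] at hand, [S n] is the set where [f d p] is positive. *)
Lemma measurable_support d n : Delta d -> measurable (S n).
Proof.
move=> Dd; have [p Sp] := support_path_nonempty n Dd.
rewrite (_ : S n = f d p @^-1` `]0, +oo[).
  by rewrite -[X in measurable X]setTI; exact: measurable_cond_density.
apply/seteqP; split => x /=; rewrite in_itv/= andbT.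
  exact: cond_density_gt0.
by move=> ?; apply/(density_support hmodel Dd Sp).
Qed.

Lemma measurable_support_path d n : Delta d -> measurable (support_path S n).
Proof.
move=> Dd.
rewrite (_ : support_path S n =
    \bigcap_(i in [set: 'I_n]) (@tnth n R ^~ i @^-1` S i)).
  apply: fin_bigcap_measurable; first exact: finite_finset.
  move=> i _; rewrite -[X in measurable X]setTI.
  by apply: measurable_tnth => //; exact: measurable_support Dd.
by apply/seteqP; split => [u Su i _|u Su i]; exact: Su.
Qed.

(** If [A] is null for [d], the density for [d] vanishes almost everywhere on [A], hence almost
    every point of [A] is outside [S n], where the density for [e] vanishes too. This carries null
    sets from one parameter to all others. *)
Lemma kappa_null d e n p A : Delta d -> Delta e -> support_path S n p ->
  measurable A -> kappa d n p A = 0%E -> kappa e n p A = 0%E.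
Proof.
move=> Dd De Sp mA.
have [_ _ ->//] := kappa_density hmodel Dd Sp.
have [_ _ ->//] := kappa_density hmodel De Sp.
have mf c : Delta c -> measurable_fun A (EFin \o f c p).
  move=> Dc; apply: measurable_funTS; apply/measurable_EFinP.
  exact: measurable_cond_density.
have f0 x : (0 <= (f d p x)%:E)%E by rewrite lee_fin cond_density_ge0.
rewrite -(eq_integral _ _ (fun x _ => gee0_abs (f0 x))).
move=> /(ae_eq_integral_abs _ mA (mf _ Dd)) ae0.
rewrite (ae_eq_integral (cst 0%E))//; [exact: integral0| exact: mf| ].
apply: filterS ae0 => x /= fx0 Ax.
have := fx0 Ax => -[fd0].
apply/congr1/cond_density_eq0 => // Sx.
by have := cond_density_gt0 Dd Sp Sx; rewrite fd0 ltxx.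
Qed.

Lemma kappa_off_support d n p : Delta d -> support_path S n p ->
  kappa d n p (~` S n) = 0%E.
Proof.
move=> Dd Sp; have [_ _ ->] := kappa_density hmodel Dd Sp; last first.
  exact: measurableC (measurable_support n Dd).
by apply: integral0_eq => x nSx; rewrite cond_density_eq0.
Qed.

Lemma disintegration_process d n (F : n.-tuple R * R -> \bar R) : Delta d ->
  measurable_fun setT F -> (forall z, 0 <= F z)%E ->
  (\int[P d]_w F (hist U n w, U n w) =
   \int[P d]_w \int[kappa d n (hist U n w)]_y F (hist U n w, y))%E.
Proof.
move=> Dd; apply: disintegration => //; first exact: measurable_hist.
by move=> A B mA mB; rewrite (kappa_cond_distribution hmodel).
Qed.

(** Turns a null statement about each conditional distribution into an almost sure one about the
    process, by disintegrating the indicator of the exceptional set. *)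
Lemma ae_transition d n (N : set (n.-tuple R * R)) : Delta d -> measurable N ->
  (forall p, support_path S n p -> kappa d n p (xsection N p) = 0%E) ->
  {ae P d, forall w, support_path S n (hist U n w) -> ~ N (hist U n w, U n w)}.
Proof.
(* Only supported pasts are kept in [A], because [N0] controls no others. *)
move=> Dd mN N0; pose A := N `&` (support_path S n `*` setT).
have mA : measurable A.
  apply: measurableI => //; apply: measurableX => //.
  exact: measurable_support_path Dd.
have mhU : measurable_fun setT (fun w => (hist U n w, U n w)).
  by apply: measurable_fun_pair => //; exact: measurable_hist.
exists ((fun w => (hist U n w, U n w)) @^-1` A); split.
- by rewrite -[X in measurable X]setTI; exact: mhU.
- rewrite -[X in P d X]setIT -integral_indic//; last first.
    by rewrite -[X in measurable X]setTI; exact: mhU.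
  have mI : measurable_fun setT (fun z => (\1_A z)%:E : \bar R).
    by apply/measurable_EFinP; exact: measurable_indic.
  have := disintegration_process Dd mI.
  rewrite (_ : (fun w => _) = (fun w => (\1_A (hist U n w, U n w))%:E)); last first.
    by [].
  move=> ->; last by move=> z; rewrite lee_fin.
  apply: integral0_eq => w _.
  have [Sw|Sw] := pselect (support_path S n (hist U n w)); last first.
    apply: integral0_eq => x _; rewrite indicE memNset//.
    by move=> [_ [/= Sw' _]].
  rewrite -(N0 _ Sw) -[in RHS](setIT (xsection _ _)) -integral_indic//; last first.
    exact: measurable_xsection.
  apply: eq_integral => x _; rewrite !indicE mem_xsection.
  rewrite (_ : (_ \in A) = ((hist U n w, x) \in N))//.
  by apply/idP/idP; rewrite !inE; [case|].
- by move=> w /= /not_implyP[Sw /contrapT Nw].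
Qed.

(** From a supported past the next observation leaves [S n] with conditional probability zero; the
    countably many exceptional sets have a null union. *)
Lemma ae_support d : Delta d ->
  {ae P d, forall w, forall n, support_path S n (hist U n w)}.
Proof.
move=> Dd; apply: ae_foralln; elim=> [|n IH].
  by apply: aeW => w; case.
have mN : measurable [set z : n.-tuple R * R | ~ S n z.2].
  rewrite (_ : [set _ | _] = snd @^-1` (~` S n))//.
  rewrite -[X in measurable X]setTI; apply: measurable_snd => //.
  exact: measurableC (measurable_support n Dd).
apply: filterS2 IH (ae_transition Dd mN _) => [w Sw /(_ Sw) /contrapT Sx|p Sp].
  by rewrite histS; apply/support_path_rcons.
rewrite -(kappa_off_support Dd Sp); congr (kappa _ _ _ _).
by apply/seteqP; split => x; rewrite /xsection /= inE.
Qed.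

End model_facts.

(** * A common threshold for two oppositely ordered functions *)

Section opposite_monotonicity.
Context (T : Type) (R : realType) (A : set T) (X Y : T -> R).

(* X crosses the level 1 where Y crosses the level y = sup of Y over X > 1,
   so X - 1 and Y - y have opposite signs. *)
Lemma opposite_crossing : (forall x, A x -> 0 <= Y x) ->
  (forall x v, A x -> A v -> X x < X v -> Y v <= Y x) ->
  (exists2 x, A x & X x <= 1) ->
  exists2 y, 0 <= y & forall x, A x -> (X x - 1) * (Y x - y) <= 0.
Proof.
move=> Y0 XY [x0 Ax0 Xx0]; pose B := [set Y v | v in [set v | A v /\ 1 < X v]].
have ubB x : A x -> X x <= 1 -> ubound B (Y x).
  by move=> Ax X1 _ [v [Av Xv] <-]; apply: XY => //; exact: le_lt_trans Xv.
(* If [X] never exceeds 1 on [A], the threshold 0 works, since [Y] is nonnegative. *)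
have [B0|/set0P Bn0] := eqVneq B set0.
  exists 0 => // x Ax; rewrite subr0 mulr_le0_ge0 ?Y0// subr_le0 leNgt.
  apply/negP => X1; suff : B (Y x) by rewrite B0.
  by exists x.
(* The point [x0] with [X x0 <= 1] makes the supremum finite: [Y x0] bounds [B]. *)
have supB : has_sup B by split => //; exists (Y x0); exact: ubB.
exists (sup B) => [|x Ax].
  have [b Bb] := Bn0; apply: (@le_trans _ _ b); last exact: ub_le_sup supB.2 _ Bb.
  by case: Bb => v [Av _] <-; exact: Y0.
have [X1|X1] := leP (X x) 1.
  rewrite mulr_le0_ge0 ?subr_le0 ?subr_ge0//; apply: ge_sup => //.
  exact: ubB.
rewrite mulr_ge0_le0 ?subr_le0 ?subr_ge0 ?(ltW X1)//.
by apply: ub_le_sup; [exact: supB.2|exists x].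
Qed.

End opposite_monotonicity.

(** * Likelihood ratios and sufficient statistics *)

Section likelihood_ratios.
Context (R : realType) (dO : measure_display) (Omega : measurableType dO).
Variables (Delta : set R) (P : R -> probability Omega R)
  (U : nat -> {mfun Omega >-> R}) (S : nat -> set R)
  (mu : nat -> {measure set R -> \bar R})
  (kappa : R -> forall n : nat, R.-pker (n.-tuple R) ~> R)
  (f : forall (d : R) (n : nat), n.-tuple R -> R -> R).
Hypothesis hmodel : process_model Delta P U S mu kappa f.

Lemma measurable_cond_lr e d n : Delta e -> Delta d ->
  measurable_fun [set: n.-tuple R * R] (fun z => cond_lr f e d z.1 z.2).
Proof.
by move=> De Dd; apply: measurable_divr; exact: (density_jointly_measurable hmodel).
Qed.

Lemma measurable_cond_lr_section e d n p : Delta e -> Delta d ->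
  support_path S n p -> measurable_fun setT (cond_lr f e d p).
Proof.
by move=> De Dd Sp; apply: measurable_divr; exact: (measurable_cond_density hmodel).
Qed.

Lemma cond_lr_gt0 e d n p x : Delta e -> Delta d -> support_path S n p ->
  S n x -> 0 < cond_lr f e d p x.
Proof.
by move=> De Dd Sp Sx; rewrite divr_gt0//; exact: (cond_density_gt0 hmodel).
Qed.

Lemma cond_lr_ge0 e d n p x : Delta e -> Delta d -> support_path S n p ->
  0 <= cond_lr f e d p x.
Proof.
by move=> De Dd Sp; rewrite divr_ge0//; exact: (cond_density_ge0 hmodel).
Qed.

Lemma cond_lr_eq0 e d n p x : Delta d -> support_path S n p -> ~ S n x ->
  cond_lr f e d p x = 0.
Proof.
by move=> Dd Sp nSx; rewrite /cond_lr (cond_density_eq0 hmodel)// mul0r.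
Qed.

(** Holds at every point, not just almost everywhere: on [S n] the denominator is positive, and off
    [S n] both densities vanish. *)
Lemma cond_lrK e d n p x : Delta e -> Delta d -> support_path S n p ->
  cond_lr f e d p x * f e p x = f d p x.
Proof.
move=> De Dd Sp; have [Sx|Sx] := pselect (S n x); last first.
  by rewrite !(cond_density_eq0 hmodel _ Sp Sx)// mulr0.
by rewrite divfK// gt_eqF// (cond_density_gt0 hmodel).
Qed.

Lemma joint_density_rcons d n (p : n.-tuple R) x :
  joint_density f d [tuple of rcons p x] = joint_density f d p * f d p x.
Proof. exact: (path_prod_rcons (f d)). Qed.

Lemma joint_density_gt0 d n p : Delta d -> support_path S n p ->
  0 < joint_density f d p.
Proof.
by move=> Dd; apply: (path_prod_gt0 (F := f d)) => m q x;
  exact: (cond_density_gt0 hmodel).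
Qed.

Lemma joint_density_ge0 d n (p : n.-tuple R) : Delta d -> 0 <= joint_density f d p.
Proof.
move=> Dd; have [Sp|Sp] := pselect (support_path S n p).
  exact/ltW/joint_density_gt0.
rewrite [joint_density _ _ _](path_prod_notin_support (F := f d) _ Sp)// => m q x.
exact: (cond_density_eq0 hmodel).
Qed.

Lemma measurable_joint_density d n : Delta d ->
  measurable_fun setT (@joint_density R f d n).
Proof.
by move=> Dd; apply: (measurable_path_prod (F := f d)) => m;
  exact: (density_jointly_measurable hmodel).
Qed.

Lemma joint_lr_rcons e d n (p : n.-tuple R) x :
  joint_lr f e d [tuple of rcons p x] = joint_lr f e d p * cond_lr f e d p x.
Proof. exact: (path_prod_rcons (fun n => cond_lr f e d (n := n))). Qed.

Lemma joint_lr_notin_support e d n p : Delta d -> ~ support_path S n p ->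
  joint_lr f e d p = 0.
Proof.
move=> Dd Sp; apply: (path_prod_notin_support
  (F := fun n => cond_lr f e d (n := n)) _ Sp) => m q x.
exact: cond_lr_eq0.
Qed.

Lemma joint_lr_ge0 e d n (p : n.-tuple R) : Delta e -> Delta d ->
  0 <= joint_lr f e d p.
Proof.
move=> De Dd; have [Sp|Sp] := pselect (support_path S n p); last first.
  by rewrite joint_lr_notin_support.
apply: ltW; apply: (path_prod_gt0 (F := fun n => cond_lr f e d (n := n)) _ Sp).
by move=> m q x; exact: cond_lr_gt0.
Qed.

Lemma measurable_joint_lr e d n : Delta e -> Delta d ->
  measurable_fun setT (@joint_lr R f e d n).
Proof.
move=> De Dd; apply: (measurable_path_prod (F := fun n => cond_lr f e d (n := n))).
by move=> m; exact: measurable_cond_lr.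
Qed.

(** * One-step consequences of sufficiency and monotone likelihood ratio *)

Section sufficient_statistic.
Variables (n : nat) (t : n.+1.-tuple R -> R) (nu : {measure set R -> \bar R})
  (g : R -> R -> R).
Hypothesis hsuff : sufficient Delta P U S f t nu g.

(** The factorisation equals a positive joint density, so its nonnegative factor [g d (t u)] cannot
    be zero. *)
Lemma sufficient_gt0 d u : Delta d -> support_path S n.+1 u -> 0 < g d (t u).
Proof.
move=> Dd Su; have [hg [q [q0 fE]]] := hsuff.
have := joint_density_gt0 Dd Su; rewrite fE//.
have [_ g0 _] := hg _ Dd.
by rewrite lt0r mulf_eq0 negb_or lt0r g0 => /andP[/andP[-> _] _].
Qed.

(** Each conditional density is the joint density of the extended path over that of the past; after
    [q] cancels, the densities of the past form a factor free of [x]. *)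
Lemma cond_lr_sufficient e d p x : Delta e -> Delta d ->
  support_path S n p -> S n x ->
  let u := [tuple of rcons p x] in
  cond_lr f e d p x =
  g d (t u) / g e (t u) * (joint_density f e p / joint_density f d p).
Proof.
move=> De Dd Sp Sx u; have Su : support_path S n.+1 u by exact/support_path_rcons.
have [_ [q [q0 fE]]] := hsuff.
have fE' c : Delta c -> f c p x = g c (t u) * q u / joint_density f c p.
  move=> Dc; rewrite -fE// joint_density_rcons mulrAC divff ?mul1r//.
  by rewrite gt_eqF// joint_density_gt0.
(* Cancelling [q u] is allowed because a zero there would annihilate a positive conditional
   density. *)
have qu0 : q u != 0.
  apply/eqP => qu; have := cond_density_gt0 hmodel De Sp Sx.
  by rewrite fE'// qu mulr0 mul0r ltxx.
rewrite /cond_lr !fE'//; field.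
by rewrite qu0 !gt_eqF ?joint_density_gt0 ?sufficient_gt0.
Qed.

Hypothesis hmlr : mlr_property Delta (t @` support_path S n.+1) g.

(** Monotonicity of the unconditional ratio of the statistic passes to the conditional ratio, as the
    two differ by a nonnegative factor depending on the past alone. *)
Lemma cond_lr_nondecreasing e d p x v : Delta e -> Delta d -> e <= d ->
  support_path S n p -> S n x -> S n v ->
  t [tuple of rcons p x] <= t [tuple of rcons p v] ->
  cond_lr f e d p x <= cond_lr f e d p v.
Proof.
move=> De Dd ed Sp Sx Sv txv; rewrite !cond_lr_sufficient// ler_wpM2r//.
  by rewrite divr_ge0// joint_density_ge0.
apply: hmlr => //; [exists [tuple of rcons p x]|exists [tuple of rcons p v]];
  by [exact/support_path_rcons|].
Qed.

(** Otherwise [f d p - f e p] is nonnegative with integral 0, so it vanishes almost everywhere; but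
    it is positive on [S n], so [f e p] vanishes almost everywhere, against its mass 1. The point
    found here is the one that [opposite_crossing] asks for. *)
Lemma cond_lr_le1 e d p : Delta e -> Delta d -> support_path S n p ->
  exists2 x, S n x & cond_lr f e d p x <= 1.
Proof.
move=> De Dd Sp; apply: contrapT => nle1.
have lr1 x : S n x -> 1 < cond_lr f e d p x.
  by move=> Sx; rewrite ltNge; apply/negP => ?; apply: nle1; exists x.
have lef x : f e p x <= f d p x.
  have [Sx|Sx] := pselect (S n x); last first.
    by rewrite !(cond_density_eq0 hmodel _ Sp Sx).
  rewrite -(cond_lrK x De Dd Sp) ler_peMl ?(cond_density_ge0 hmodel)//.
  exact/ltW/lr1.
have me : measurable_fun setT (EFin \o f e p).
  by apply/measurable_EFinP; exact: (measurable_cond_density hmodel).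
have md : measurable_fun setT (EFin \o f d p).
  by apply/measurable_EFinP; exact: (measurable_cond_density hmodel).
pose h x := f d p x - f e p x.
have mh : measurable_fun setT (EFin \o h).
  apply/measurable_EFinP/measurable_funB;
    exact: (measurable_cond_density hmodel).
have h0 x : (0 <= (h x)%:E)%E by rewrite lee_fin subr_ge0.
have : (\int[mu n]_x (f d p x)%:E =
    \int[mu n]_x (f e p x)%:E + \int[mu n]_x (h x)%:E)%E.
  rewrite -ge0_integralD//; last first.
    by move=> x _; rewrite lee_fin (cond_density_ge0 hmodel).
  by apply: eq_integral => x _; rewrite -EFinD addrC subrK.
rewrite !(integral_cond_density hmodel)// => int1.
have : (\int[mu n]_x `|(h x)%:E| = 0)%E.
  under eq_integral do rewrite gee0_abs//.
  move: int1; case: (\int[mu n]_x (h x)%:E)%E => [r| |]//.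
  by rewrite -EFinD => -[] r1; congr (_%:E); lra.
move=> /(ae_eq_integral_abs _ measurableT mh) ae0.
have := integral_cond_density hmodel De Sp.
rewrite (ae_eq_integral (cst 0%E))//; last first.
  apply: filterS ae0 => x /= /(_ I) [/eqP]; rewrite subr_eq0 => /eqP fde _.
  congr (_%:E); apply: (cond_density_eq0 hmodel) => // Sx.
  have := lr1 _ Sx; rewrite /cond_lr fde divff ?ltxx//.
  by rewrite gt_eqF// (cond_density_gt0 hmodel).
by rewrite integral0 => -[] /esym/eqP; rewrite oner_eq0.
Qed.

Lemma cond_lr_expectation_le1 d e dp p : Delta d -> Delta e -> Delta dp ->
  d <= e -> e <= dp -> support_path S n p ->
  (\int[kappa d n p]_x (cond_lr f e dp p x)%:E <= 1)%E.
Proof.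
move=> Dd De Ddp de edp Sp.
pose X := cond_lr f e dp p; pose Y := cond_lr f e d p.
have YV x : S n x -> Y x = (cond_lr f d e p x)^-1.
  by move=> Sx; rewrite /Y /cond_lr invf_div.
have [||y y0 XYy] := @opposite_crossing _ _ (S n) X Y _ _ (cond_lr_le1 De Ddp Sp).
- by move=> x _; exact: cond_lr_ge0.
(* If [X x < X v], the statistic cannot be smaller at [v] than at [x], by monotonicity of [X]. As
   [d <= e], the inverse of [Y] is then no smaller at [v]. *)
- move=> x v Sx Sv; rewrite !YV// lef_pV2 ?posrE ?cond_lr_gt0// => Xxv.
  apply: cond_lr_nondecreasing => //; rewrite leNgt; apply/negP => /ltW tvx.
  have Xvx := cond_lr_nondecreasing De Ddp edp Sp Sv Sx tvx.
  by have := lt_le_trans Xxv Xvx; rewrite ltxx.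
have f0 c x : Delta c -> 0 <= f c p x.
  by move=> Dc; exact: (cond_density_ge0 hmodel).
have mf c : Delta c -> measurable_fun setT (EFin \o f c p).
  by move=> Dc; apply/measurable_EFinP; exact: (measurable_cond_density hmodel).
have mX : measurable_fun setT (EFin \o X).
  by apply/measurable_EFinP; exact: measurable_cond_lr_section.
have X0 x : 0 <= X x by exact: cond_lr_ge0.
have mXf : measurable_fun setT (fun x => (X x)%:E * (f d p x)%:E)%E.
  by apply: emeasurable_funM => //; exact: mf.
have mZ c : Delta c -> measurable_fun setT (fun x => y%:E * (f c p x)%:E)%E.
  by move=> Dc; apply: measurable_funeM; exact: mf.
have intZ c : Delta c -> (\int[mu n]_x (y%:E * (f c p x)%:E) = y%:E)%E.
  move=> Dc; rewrite ge0_integralZl ?lee_fin//; last 2 first.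
  - exact: mf.
  - by move=> x _; rewrite lee_fin f0.
  by rewrite (integral_cond_density hmodel)// mule1.
rewrite (integral_has_density (kappa_density hmodel Dd Sp))//.
(* The added [y] is the integral of [y * f e p] on the left and of [y * f dp p] on the right, which
   leaves two nonnegative integrands to be compared pointwise. *)
rewrite -(leeD2rE _ _ (isT : y%:E \is a fin_num)).
have Xf0 x : (0 <= (X x)%:E * (f d p x)%:E)%E.
  by rewrite -EFinM lee_fin mulr_ge0 ?f0.
have Z0 c x : Delta c -> (0 <= y%:E * (f c p x)%:E)%E.
  by move=> Dc; rewrite -EFinM lee_fin mulr_ge0 ?f0.
have -> : (\int[mu n]_x ((X x)%:E * (f d p x)%:E) + y%:E =
    \int[mu n]_x ((X x)%:E * (f d p x)%:E + y%:E * (f e p x)%:E))%E.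
  by rewrite ge0_integralD// ?intZ//; [move=> x _; exact: Z0|exact: mZ].
have -> : (1 + y%:E =
    \int[mu n]_x ((f d p x)%:E + y%:E * (f dp p x)%:E))%E.
  rewrite ge0_integralD// ?intZ// ?(integral_cond_density hmodel)//.
  - by move=> x _; rewrite lee_fin f0.
  - exact: mf.
  - by move=> x _; exact: Z0.
  - exact: mZ.
apply: ge0_le_integral => //.
- by move=> x _; rewrite adde_ge0 ?Z0.
- by apply: emeasurable_funD => //; exact: mZ.
- by apply: emeasurable_funD; [exact: mf|exact: mZ].
move=> x _; rewrite -!EFinM -!EFinD lee_fin.
have [Sx|Sx] := pselect (S n x); last first.
  by rewrite !(cond_density_eq0 hmodel _ Sp Sx)// !mulr0.
have -> : f d p x = Y x * f e p x by rewrite cond_lrK.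
have -> : f dp p x = X x * f e p x by rewrite cond_lrK.
(* This is [(X x - 1) * (Y x - y) <= 0] multiplied by [f e p x]. *)
by have := XYy _ Sx; have := f0 _ x De; nra.
Qed.

End sufficient_statistic.

Lemma measurable_wrt_hist n (g : n.-tuple R -> R) : measurable_fun setT g ->
  measurable_wrt (hist_sigma U n) (g \o hist U n).
Proof.
move=> mg B mB; exists (g @^-1` B); last by rewrite setTI.
by rewrite -[X in measurable X]setTI; exact: mg.
Qed.

Lemma measurable_hist_sigma n A : hist_sigma U n A -> measurable A.
Proof. by move=> [B mB <-]; apply: measurable_hist. Qed.

(** * From the one-step bound to the supermartingale property *)

Section supermartingale.
Variables (d e dp : R).
Hypotheses (Dd : Delta d) (De : Delta e) (Ddp : Delta dp).
Hypothesis cond_lr_mean : forall n p, support_path S n p ->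
  (\int[kappa d n p]_x (cond_lr f e dp p x)%:E <= 1)%E.

Let L n (p : n.-tuple R) : R := joint_lr f e dp p.
(** The conditional expectation of the next likelihood ratio given the past [p], with extended real
    values until [G_le] shows it finite. *)
Let G n (p : n.-tuple R) : \bar R :=
  (\int[kappa d n p]_x (L [tuple of rcons p x])%:E)%E.

Let L_ge0 n (p : n.-tuple R) : 0 <= L p.
Proof. exact: joint_lr_ge0. Qed.

Let mL n : measurable_fun setT (@L n).
Proof. exact: measurable_joint_lr. Qed.

Let mLrcons n : measurable_fun setT
  (fun z : n.-tuple R * R => (L [tuple of rcons z.1 z.2])%:E).
Proof.
apply/measurable_EFinP; apply: (measurableT_comp (@mL n.+1)).
exact: measurable_tuple_rcons.
Qed.

Let G_ge0 n (p : n.-tuple R) : (0 <= G p)%E.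
Proof. by apply: integral_ge0 => x _; rewrite lee_fin. Qed.

(** On the support [L p] factors out and the one-step bound remains; off the support every extension
    is off it too, so the integrand is zero. *)
Let G_le n (p : n.-tuple R) : (G p <= (L p)%:E)%E.
Proof.
have [Sp|Sp] := pselect (support_path S n p); last first.
  rewrite /G integral0_eq ?lee_fin// => x _.
  by rewrite /L joint_lr_notin_support// support_path_rcons => -[].
rewrite /G; under eq_integral do rewrite /L joint_lr_rcons EFinM.
rewrite ge0_integralZl ?lee_fin//.
- by rewrite -[leRHS]mule1 lee_wpmul2l ?lee_fin//; exact: cond_lr_mean.
- by apply/measurable_EFinP; exact: measurable_cond_lr_section.
- by move=> x _; rewrite lee_fin cond_lr_ge0.
Qed.

Let mG n : measurable_fun setT (@G n).
Proof.
apply: (measurable_fun_integral_sfinite_kernel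
  (fun z : n.-tuple R * R => (L [tuple of rcons z.1 z.2])%:E) (kappa d n)).
- by move=> z; rewrite lee_fin.
- exact: mLrcons.
Qed.

Let mhist n : measurable_fun setT (hist U n).
Proof. exact: measurable_hist. Qed.

(** The defining identity of conditional expectation, since the events of [hist_sigma U n] are the
    preimages of measurable [B]; it disintegrates the indicator of [B] times [L]. *)
Let G_step n (B : set (n.-tuple R)) : measurable B ->
  (\int[P d]_(w in hist U n @^-1` B) (L (hist U n.+1 w))%:E =
   \int[P d]_(w in hist U n @^-1` B) G (hist U n w))%E.
Proof.
move=> mB; rewrite [LHS]integral_mkcond [RHS]integral_mkcond.
pose F (z : n.-tuple R * R) : \bar R :=
  ((\1_B z.1)%:E * (L [tuple of rcons z.1 z.2])%:E)%E.
transitivity (\int[P d]_w F (hist U n w, U n w))%E.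
  apply: eq_integral => w _; rewrite /F patchE histS indicE/=.
  rewrite (_ : (w \in _) = (hist U n w \in B))//.
  by case: ifP; rewrite ?mul1e ?mul0e.
rewrite (disintegration_process hmodel)//; last 2 first.
- apply: emeasurable_funM; last exact: mLrcons.
  apply/measurable_EFinP.
  exact: (measurableT_comp (measurable_indic mB) measurable_fst).
- by move=> z; rewrite /F -EFinM lee_fin mulr_ge0// indicE.
apply: eq_integral => w _; rewrite patchE /F /= indicE.
rewrite (_ : (w \in _) = (hist U n w \in B))//.
case: ifP => _; first by apply: eq_integral => x _; rewrite mul1e.
by rewrite integral0_eq// => x _; rewrite mul0e.
Qed.

Let mLhist n : measurable_fun setT (fun w => (L (hist U n w))%:E).
Proof. by apply/measurable_EFinP; exact: (measurableT_comp (@mL n) (@mhist n)). Qed.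

(** The mean starts at 1 and, by [G_step] over the whole space and [G_le], never grows. *)
Let int_L n : (\int[P d]_w (L (hist U n w))%:E <= 1)%E.
Proof.
elim: n => [|n IH].
  under eq_integral do rewrite /L /joint_lr big_ord0.
  by rewrite integral_cst// mul1e; exact: probability_le1.
have := @G_step n setT measurableT; rewrite preimage_setT => ->.
apply: le_trans IH; apply: ge0_le_integral => //.
exact: (measurableT_comp (@mG n) (@mhist n)).
Qed.

Let integrable_L n : (P d).-integrable setT (EFin \o (fun w => L (hist U n w))).
Proof.
apply/integrableP; split; first exact: mLhist.
under eq_integral do rewrite /= ger0_norm//.
exact: le_lt_trans (int_L n) (ltry _).
Qed.

Lemma joint_lr_supermartingale :
  supermartingale (P d) U (fun n w => joint_lr f e dp (hist U n w)).
Proof.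
split=> [n|n|n].
- exact: (@measurable_wrt_hist n (@L n)).
- exact: integrable_L.
have GE p : (fine (@G n p))%:E = G p.
  rewrite fineK// ge0_fin_numE// (le_lt_trans (G_le p))//.
  exact: ltry.
exists (fun w => fine (G (hist U n w))); last first.
  by apply: aeW => w; rewrite -lee_fin GE; exact: G_le.
have mfG : measurable_fun setT (fun p => fine (@G n p)).
  exact: (measurableT_comp (fine_measurable measurableT) (@mG n)).
split.
- exact: (@measurable_wrt_hist n (fun p => fine (G p))).
- apply: (le_integrable measurableT _ _ (integrable_L n)).
    by apply/measurable_EFinP; exact: (measurableT_comp mfG (@mhist n)).
  move=> w _; rewrite /= lee_fin !ger0_norm ?fine_ge0// -lee_fin GE.
  exact: G_le.
- move=> _ [B mB <-]; rewrite setTI G_step//.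
  by apply: eq_integral => w _; rewrite GE.
Qed.

End supermartingale.

(** Integrals and almost sure bounds ignore null sets, so the conditional expectations of [M] serve
    for [N]. Adaptedness is assumed for [N], because a change on a null set may destroy it. *)
Lemma supermartingale_ae_eq (Q : probability Omega R) (M N : nat -> Omega -> R) :
  (forall n, measurable_wrt (hist_sigma U n) (N n)) ->
  {ae Q, forall w, forall n, N n w = M n w} ->
  supermartingale Q U M -> supermartingale Q U N.
Proof.
have mW n (g : Omega -> R) :
    measurable_wrt (hist_sigma U n) g -> measurable_fun setT g.
  by move=> mg _ B mB; rewrite setTI; apply/measurable_hist_sigma/mg.
move=> aN NM [aM iM eM].
have mM n := mW _ _ (aM n); have mN n := mW _ _ (aN n).
split=> // n.
  have /integrableP[mMn finM] := iM n.
  have mNn : measurable_fun setT (EFin \o N n) by exact/measurable_EFinP.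
  apply/integrableP; split=> //.
  rewrite (ae_eq_integral (fun w => `|(M n w)%:E|)%E)//.
  - exact: measurableT_comp.
  - exact: measurableT_comp.
  - by apply: filterS NM => w /(_ n) /= -> _.
have [Y [mY iY YE] YM] := eM n; exists Y; last first.
  by apply: filterS2 YM NM => w /= + /(_ n) ->.
split=> // A nA; have mA := measurable_hist_sigma nA.
rewrite YE//; apply: ae_eq_integral => //.
- by apply/measurable_EFinP/measurable_funTS.
- by apply/measurable_EFinP/measurable_funTS.
- by apply: filterS NM => w /(_ n.+1) -> _.
Qed.


Lemma stat_lr_productE (t : forall n, n.-tuple R -> R)
    (pT : forall n, n.-tuple R -> R -> R) n (u : n.-tuple R) :
  stat_lr_product t pT u =
  path_prod (fun m p x => pT m p (t m.+1 [tuple of rcons p x])) u.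
Proof. by apply: eq_bigr => i _; rewrite prefix_tupleS. Qed.

(** * Versions of the conditional likelihood ratio of the statistics *)

Section sufficient_sequence.
Variables (t : forall n, n.-tuple R -> R) (nu : nat -> {measure set R -> \bar R})
  (fT : nat -> R -> R -> R) (e dp : R).
Hypotheses (De : Delta e) (Ddp : Delta dp).
Hypothesis mt : forall n, (0 < n)%N -> measurable_fun [set: n.-tuple R] (@t n).
Hypothesis hsuff : forall n, (0 < n)%N ->
  sufficient Delta P U S f (@t n) (nu n) (fT n).

(** The right side of [cond_lr_sufficient] as a function of the value [x] of the statistic: an
    explicit version, for which equality holds on every supported path. *)
Definition sufficient_stat_lr n (p : n.-tuple R) x : R :=
  fT n.+1 dp x / fT n.+1 e x * (joint_density f e p / joint_density f dp p).

Lemma sufficient_stat_lrE n (p : n.-tuple R) x : support_path S n p -> S n x ->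
  sufficient_stat_lr p (t [tuple of rcons p x]) = cond_lr f e dp p x.
Proof. by move=> Sp Sx; rewrite (cond_lr_sufficient (hsuff _)). Qed.

Lemma measurable_stat_step n :
  measurable_fun setT (fun z : n.-tuple R * R => t [tuple of rcons z.1 z.2]).
Proof.
apply: (measurableT_comp (mt (ltn0Sn n))).
exact: measurable_tuple_rcons.
Qed.

Let measurable_stat_section n (p : n.-tuple R) :
  measurable_fun setT (fun x : R => t [tuple of rcons p x]).
Proof.
apply: (measurableT_comp (mt (ltn0Sn n))).
exact: measurable_tuple_rcons.
Qed.

(** Pulled back to the observation, the mass of [B] is an integral over its preimage under the
    statistic; there the candidate equals [cond_lr f e dp p] on [S n], and multiplying by [f e p]
    gives [f dp p]. *)
Lemma sufficient_stat_lr_version :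
  stat_cond_lr_version S kappa t e dp sufficient_stat_lr.
Proof.
move=> n; have [hg _] := hsuff (ltn0Sn n).
have [me e0 _] := hg _ De; have [mdp dp0 _] := hg _ Ddp.
have lr0 p x : 0 <= sufficient_stat_lr (n := n) p x.
  by rewrite mulr_ge0// divr_ge0// joint_density_ge0.
have mlr : measurable_fun [set: n.-tuple R * R]
    (fun z => sufficient_stat_lr z.1 z.2).
  apply: measurable_funM.
    exact: (measurableT_comp (measurable_divr mdp me) measurable_snd).
  exact: (measurableT_comp (measurable_divr (measurable_joint_density De)
    (measurable_joint_density Ddp)) measurable_fst).
split=> // p Sp.
have mlrp : measurable_fun setT (sufficient_stat_lr p).
  exact: (measurableT_comp mlr (pair1_measurable p)).
have mlrp' : measurable_fun setT (EFin \o sufficient_stat_lr p).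
  exact/measurable_EFinP.
pose T x := t [tuple of rcons p x].
have mT : measurable_fun setT T by exact: measurable_stat_section.
split=> // B mB; rewrite /stat_cond_law ge0_integral_pushforward//; last 2 first.
- by apply/measurable_EFinP; exact: measurable_funTS.
- by move=> x _; rewrite lee_fin.
have mTB : measurable (T @^-1` B) by rewrite -[X in measurable X]setTI; exact: mT.
rewrite {1}/pushforward; have [_ _ ->//] := kappa_density hmodel Ddp Sp.
rewrite [LHS]integral_mkcond [RHS]integral_mkcond.
rewrite (integral_has_density (kappa_density hmodel De Sp)); last 2 first.
- apply/(measurable_restrictT _ mTB); apply: measurable_funTS.
  exact: (measurableT_comp mlrp' mT).
- by move=> x; rewrite patchE; case: ifP => // _; rewrite lee_fin.
apply: eq_integral => x _; rewrite !patchE -/T.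
case: ifP => _; last by rewrite mul0e.
have [Sx|Sx] := pselect (S n x); last first.
  by rewrite !(cond_density_eq0 hmodel _ Sp Sx)// mule0.
by rewrite -EFinM /= sufficient_stat_lrE// cond_lrK.
Qed.

Lemma stat_lr_product_support n (u : n.-tuple R) : support_path S n u ->
  stat_lr_product t sufficient_stat_lr u = joint_lr f e dp u.
Proof.
move=> Su; rewrite stat_lr_productE; apply: eq_bigr => i _.
apply: sufficient_stat_lrE; last exact: Su.
exact: support_path_prefix (ltnW (ltn_ord i)) Su.
Qed.

Variable pT : forall n, n.-tuple R -> R -> R.
Hypothesis hpT : stat_cond_lr_version S kappa t e dp pT.

(** Two densities relative to the law of the statistic under [e] agree almost everywhere for that
    law. Pulling back gives a null set for [kappa e n p], and [kappa_null] moves it to [d]. *)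
Lemma stat_cond_lr_unique d n (p : n.-tuple R) : Delta d -> support_path S n p ->
  kappa d n p [set x | pT p (t [tuple of rcons p x]) <> cond_lr f e dp p x] = 0%E.
Proof.
move=> Dd Sp.
have mN : measurable [set x | pT p (t [tuple of rcons p x]) <> cond_lr f e dp p x].
  have [_ _ /(_ _ Sp)[mp _ _]] := hpT n; apply: measurable_neqr.
    exact: (measurableT_comp mp (measurable_stat_section p)).
  exact: measurable_cond_lr_section.
pose T x := t [tuple of rcons p x].
have mT : measurable_fun setT T by exact: measurable_stat_section.
have [_ _ /(_ _ Sp)[mq q0 qE]] := sufficient_stat_lr_version n.
have [_ _ /(_ _ Sp)[mp p0 pE]] := hpT n.
have iq : (pushforward (kappa e n p) T).-integrable setT
    (EFin \o sufficient_stat_lr p).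
  apply/integrableP; split; first exact/measurable_EFinP.
  under eq_integral do rewrite gee0_abs ?lee_fin//.
  rewrite -qE// /stat_cond_law /pushforward preimage_setT.
  by rewrite prob_kernel ltry.
have mp' : measurable_fun setT (EFin \o pT p) by exact/measurable_EFinP.
have /(_ mT)[B [mB B0 qpB]] : ae_eq (pushforward (kappa e n p) T) setT
    (EFin \o sufficient_stat_lr p) (EFin \o pT p).
  move=> ?; apply: (integral_ae_eq measurableT iq mp') => B _ mB.
  by rewrite -qE// pE.
have {}B0 : kappa e n p (T @^-1` B) = 0%E by [].
have mTB : measurable (T @^-1` B) by rewrite -[X in measurable X]setTI; exact: mT.
have mS := measurable_support hmodel n De.
(* The explicit version equals the conditional ratio only on [S n], so the complement of [S n] joins
   the exceptional set. *)
apply: (subset_measure0 mN _ (B := T @^-1` B `|` ~` S n)).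
- by apply: measurableU => //; exact: measurableC.
- move=> x neq; have [Sx|] := pselect (S n x); last by right.
  left; apply: qpB => /= /(_ I) [] qpx; apply: neq.
  by rewrite -qpx sufficient_stat_lrE.
apply: (kappa_null hmodel De) => //.
  by apply: measurableU => //; exact: measurableC.
apply/eqP; rewrite eq_le measure_ge0 andbT.
apply: le_trans (measureU2 (kappa e n p) mTB (measurableC mS)) _.
by rewrite [X in (X + _)%E]B0 [X in (_ + X)%E](kappa_off_support hmodel)// adde0.
Qed.

Lemma measurable_stat_lr_step n : measurable_fun setT
  (fun z : n.-tuple R * R => pT z.1 (t [tuple of rcons z.1 z.2])).
Proof.
have [mpT _ _] := hpT n.
have mg : measurable_fun [set: n.-tuple R * R]
    (fun z => (z.1, t [tuple of rcons z.1 z.2])).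
  by apply: measurable_fun_pair => //; exact: measurable_stat_step.
exact: (measurableT_comp mpT mg).
Qed.

Lemma measurable_stat_lr_product n :
  measurable_fun setT (@stat_lr_product R t pT n).
Proof.
rewrite (_ : @stat_lr_product R t pT n = path_prod
    (fun m p x => pT p (t [tuple of rcons p x])) (n := n)); last first.
  by apply/funext => u; exact: stat_lr_productE.
by apply: measurable_path_prod => m; exact: measurable_stat_lr_step.
Qed.

(** Off one null set all factors agree at all times and the history stays in the support; the
    products then agree by induction on their length. *)
Lemma ae_stat_lr_product d : Delta d ->
  {ae P d, forall w, forall n,
    stat_lr_product t pT (hist U n w) = joint_lr f e dp (hist U n w)}.
Proof.
move=> Dd.
have step : {ae P d, forall w, forall n, support_path S n (hist U n w) ->
    pT (hist U n w) (t [tuple of rcons (hist U n w) (U n w)]) =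
    cond_lr f e dp (hist U n w) (U n w)}.
  apply: ae_foralln => n.
  pose N := [set z : n.-tuple R * R |
    pT z.1 (t [tuple of rcons z.1 z.2]) <> cond_lr f e dp z.1 z.2].
  have mN : measurable N.
    apply: measurable_neqr; first exact: measurable_stat_lr_step.
    exact: measurable_cond_lr.
  have N0 p : support_path S n p -> kappa d n p (xsection N p) = 0%E.
    move=> Sp; rewrite -(stat_cond_lr_unique Dd Sp); congr (kappa _ _ _ _).
    by apply/seteqP; split => x; rewrite /xsection /= inE.
  by apply: filterS (ae_transition hmodel Dd mN N0) => w /[apply] /contrapT.
apply: filterS2 (ae_support hmodel Dd) step => w Sw pTw; elim=> [|n IH].
  by rewrite /stat_lr_product /joint_lr !big_ord0.
rewrite histS joint_lr_rcons -IH -pTw// !stat_lr_productE.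
exact: (path_prod_rcons (fun m p x => pT p (t [tuple of rcons p x]))).
Qed.

End sufficient_sequence.

End likelihood_ratios.

Theorem theorem4 (R : realType) (dO : measure_display)
    (Omega : measurableType dO)
    (Delta : set R) (P : R -> probability Omega R)
    (U : nat -> {mfun Omega >-> R}) (S : nat -> set R)
    (mu : nat -> {measure set R -> \bar R})
    (kappa : R -> forall n : nat, R.-pker (n.-tuple R) ~> R)
    (f : forall (d : R) (n : nat), n.-tuple R -> R -> R)
    (t : forall n : nat, n.-tuple R -> R)
    (nu : nat -> {measure set R -> \bar R}) (fT : nat -> R -> R -> R)
    (d0 dp : R)
    (hDelta : is_interval Delta)
    (hmodel : process_model Delta P U S mu kappa f)
    (hd0 : Delta d0) (hdp : Delta dp) (hlt : d0 < dp)
    (ht : forall n, (0 < n)%N -> measurable_fun [set: n.-tuple R] (t n))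
    (hsuff : forall n, (0 < n)%N ->
      sufficient Delta P U S f (t n) (nu n) (fT n))
    (hmlr : forall n, (0 < n)%N ->
      mlr_property Delta (t n @` support_path S n) (fT n)) :
  [/\ (exists2 pT : forall n : nat, n.-tuple R -> R -> R,
        stat_cond_lr_version S kappa t d0 dp pT &
        forall n (u : n.-tuple R), support_path S n u ->
          stat_lr_product t pT u = joint_lr f d0 dp u),
      (forall pT : forall n : nat, n.-tuple R -> R -> R,
        stat_cond_lr_version S kappa t d0 dp pT ->
        (forall d, Delta d -> {ae P d, forall w, forall n,
          stat_lr_product t pT (hist U n w) = joint_lr f d0 dp (hist U n w)}) /\
        test_supermartingale (one_sided_null Delta P d0) U
          (fun n w => stat_lr_product t pT (hist U n w))),
      test_supermartingale (one_sided_null Delta P d0) U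
        (fun n w => joint_lr f d0 dp (hist U n w)) &
      forall d, Delta d -> d <= d0 ->
        forall n (past : n.-tuple R), support_path S n past ->
          (\int[kappa d n past]_u (cond_lr f d0 dp past u)%:E <= 1)%E].
Proof.
have lr_le1 d : Delta d -> d <= d0 ->
    forall n (past : n.-tuple R), support_path S n past ->
    (\int[kappa d n past]_u (cond_lr f d0 dp past u)%:E <= 1)%E.
  move=> Dd dd0 n p Sp.
  exact: (cond_lr_expectation_le1 hmodel (hsuff _ (ltn0Sn n)) (hmlr _ (ltn0Sn n))
    Dd hd0 hdp dd0 (ltW hlt) Sp).
have lr_super d : Delta d -> d <= d0 ->
    supermartingale (P d) U (fun n w => joint_lr f d0 dp (hist U n w)).
  by move=> Dd dd0; apply: (joint_lr_supermartingale hmodel) => //; exact: lr_le1.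
split=> //.
(* The explicit version gives equality at every supported path; an arbitrary version, treated next,
   gives it almost surely. *)
- exists (sufficient_stat_lr f fT d0 dp).
    exact: (sufficient_stat_lr_version hmodel hd0 hdp ht hsuff).
  by move=> n u; exact: (stat_lr_product_support hmodel hd0 hdp hsuff).
- move=> pT hpT.
  have ae_eq_lr := ae_stat_lr_product hmodel hd0 hdp ht hsuff hpT.
  split=> //; split.
  + by move=> w; rewrite /stat_lr_product big_ord0.
  + by move=> n w; apply: prodr_ge0 => i _; have [_ + _] := hpT i; exact.
  + move=> _ [d [Dd dd0] <-].
    (* The property is carried over from the likelihood ratio process; adaptedness comes from joint
       measurability of the version [pT]. *)
    apply: (supermartingale_ae_eq _ (ae_eq_lr d Dd) (lr_super d Dd dd0)) => n.
    exact (measurable_wrt_hist U (measurable_stat_lr_product ht hpT (n := n))).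
- split.
  + by move=> w; rewrite /joint_lr big_ord0.
  + by move=> n w; exact: (joint_lr_ge0 hmodel).
  + by move=> _ [d [Dd dd0] <-]; exact: lr_super.
Qed.
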